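(* Let $X$ be a complex topological vector space with $\dim(X)>1$ and let $(S(z))_{z\in\mathbb{C}}$ be an entire $C$-regularized group of operators on $X$ such that $C$ has dense range. If $(S(z))_{z\in\mathbb{C}}$ is hypercyclic, then $(S(z))_{z\in\mathbb{C}}$ is topologically transitive.
   Context: $\mathcal{B}(X)$ denotes the set of all continuous linear operators on $X$. For $C\in\mathcal{B}(X)$, an (entire) $C$-regularized group is a family $(S(z))_{z\in\mathbb{C}}$ of operators in $\mathcal{B}(X)$ satisfying: (1) $S(0)=C$; (2) $S(z+w)C=S(z)S(w)$ for all $z,w\in\mathbb{C}$; (3) for every $x\in X$ the mapping $z\mapsto S(z)x$, $z\in\mathbb{C}$, is entire. A set $\Gamma\subset\mathcal{B}(X)$ is hypercyclic if there exists $x\in X$ such that $\{Tx : T\in\Gamma\}$ is dense in $X$, and topologically transitive if for each pair $(U,V)$ of nonempty open subsets of $X$ there exists $T\in\Gamma$ such that $T(U)\cap V\neq\emptyset$; these notions are applied to $\Gamma=\{S(z) : z\in\mathbb{C}\}$. *)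

(* Defs.v *)
(* MathComp-Analysis: a complex topological vector space is a
   [topologicalLmodType R[i]] with [R : realType]; neither local convexity nor
   the Hausdorff property is assumed. *)
From HB Require Import structures.
From mathcomp Require Import all_boot all_order all_algebra.
From mathcomp Require Import complex.
From mathcomp Require Import all_classical all_reals all_analysis.

Set Implicit Arguments.
Unset Strict Implicit.
Unset Printing Implicit Defensive.

Import Order.TTheory GRing.Theory Num.Theory.
Import numFieldNormedType.Exports.

Local Open Scope classical_set_scope.
Local Open Scope ring_scope.

(* [dim_gt V n] is dim V > n, where dim V may be infinite. *)
Definition linearly_independent (K : fieldType) (V : lmodType K) (n : nat)
    (v : 'I_n -> V) : Prop :=
  forall a : 'I_n -> K, \sum_i a i *: v i = 0 -> forall i, a i = 0.

Definition dim_gt (K : fieldType) (V : lmodType K) (n : nat) : Prop :=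
  exists v : 'I_n.+1 -> V, linearly_independent v.

(* The elements of B(X). *)
Record operator (K : numFieldType) (X : topologicalLmodType K) := Operator {
  operator_fun :> {linear X -> X};
  operator_continuous : continuous operator_fun
}.

(* The library's [derivable] requires a normed codomain, hence the explicit
   difference quotient, whose limit as h tends to 0 is taken in X. *)
Definition entire (R : realType) (X : topologicalLmodType R[i])
    (f : R[i] -> X) : Prop :=
  forall z : R[i], exists l : X,
    (fun h : R[i]^o => h^-1 *: (f (z + h) - f z)) @ (0 : R[i]^o)^' --> l.

Definition regularized_group (R : realType) (X : topologicalLmodType R[i])
    (C : operator X) (S : R[i] -> operator X) : Prop :=
  [/\ S 0 =1 C,
      forall z w : R[i], S (z + w) \o C =1 S z \o S w
    & forall x : X, entire (fun z => S z x)].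

Definition hypercyclic (K : numFieldType) (X : topologicalLmodType K)
    (Gamma : set (operator X)) : Prop :=
  exists x : X, dense [set (T : operator X) x | T in Gamma].

Definition topologically_transitive (K : numFieldType)
    (X : topologicalLmodType K) (Gamma : set (operator X)) : Prop :=
  forall U V : set X, open U -> open V -> U !=set0 -> V !=set0 ->
    exists2 T : operator X, Gamma T & (T @` U) `&` V !=set0.

(* Main.v *)
Require Import Defs.
From HB Require Import structures.
From mathcomp Require Import all_boot all_order all_algebra.
From mathcomp Require Import complex.
From mathcomp Require Import all_classical all_reals all_analysis.

(** The parameter group is all of [R[i]], so any point of an orbit can be
    moved anywhere along the orbit: if [x] has a dense orbit, some [S z x] lies
    in [U], and [S (u - z)] sends it to [S u (C x)] for whatever [u] we like.
    It remains to hit [V] with some [S u (C x)].  Now [S u (C x) = C (S u x)],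
    so these points form the image under [C] of the dense orbit of [x], and a
    continuous map with dense range takes dense sets to dense sets
    ([dense_image]). *)

Set Implicit Arguments.
Unset Strict Implicit.
Unset Printing Implicit Defensive.

Import Order.TTheory GRing.Theory Num.Theory.
Import numFieldNormedType.Exports.

Local Open Scope classical_set_scope.
Local Open Scope ring_scope.

Lemma dense_image (T U : topologicalType) (f : T -> U) (A : set T) :
  continuous f -> dense (range f) -> dense A -> dense (f @` A).
Proof.
move=> /continuousP f_cont f_dense A_dense O O_neq0 O_open.
have [y [Oy [t _ ft]]] := f_dense O O_neq0 O_open.
have preimO_neq0 : f @^-1` O !=set0 by exists t; rewrite /preimage /= ft.
have [a [Ofa Aa]] := A_dense _ preimO_neq0 (f_cont _ O_open).
by exists (f a); split=> //; exists a.
Qed.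

Lemma regularized_group_comm (R : realType) (X : topologicalLmodType R[i])
    (C : operator X) (S : R[i] -> operator X) :
  regularized_group C S -> forall z x, S z (C x) = C (S z x).
Proof.
move=> [S0 SD _] z x.
by have := SD 0 z x; rewrite /= add0r S0.
Qed.

Theorem theorem4p4 (R : realType) (X : topologicalLmodType R[i])
    (C : operator X) (S : R[i] -> operator X) :
  dim_gt X 1 ->
  regularized_group C S ->
  dense (range C) ->
  hypercyclic (range S) ->
  topologically_transitive (range S).
Proof.
move=> _ S_group C_dense [x orbit_dense] U V U_open V_open U_neq0 V_neq0.
have [_ SD _] := S_group.
have [y [Uy [_ [z _ <-] zx]]] := orbit_dense U U_neq0 U_open.
have C_orbit_dense := dense_image (@operator_continuous _ _ C) C_dense orbit_dense.
have [v [Vv [_ [_ [u _ <-] <-] ux]]] := C_orbit_dense V V_neq0 V_open.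
exists (S (u - z)); first by exists (u - z).
exists (C (S u x)); split; last by rewrite ux.
exists (S z x); first by rewrite zx.
have := SD (u - z) z x.
by rewrite /= subrK (regularized_group_comm S_group) => ->.
Qed.
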